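(* Assume Jensen's principle $\diamondsuit$. Then there is a weird space $X$ which is hereditarily separable and hereditarily Lindelöf.
   Context: All spaces are Hausdorff. A space is scattered if every nonempty subspace has an isolated point. A perfect set in a space is a nonempty closed subset with no isolated points. A space is totally disconnected if all its connected components are singletons. A space $X$ is weird iff $X$ is compact and not scattered, and there is no $P\subseteq X$ such that $P$ is perfect and totally disconnected. A space is hereditarily separable (respectively hereditarily Lindelöf) if every subspace of it is separable (respectively Lindelöf). *)

(* Defs.v *)
From HB Require Import structures.
From mathcomp Require Import all_boot all_order.
From mathcomp Require Import all_classical wochoice.
From mathcomp Require Import topology.

Set Implicit Arguments.
Unset Strict Implicit.
Unset Printing Implicit Defensive.

Import Order.TTheory.
Local Open Scope order_scope.
Local Open Scope classical_set_scope.

Section Omega1.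
Context {d : Order.disp_t} (W : orderType d).

(* Up to a unique isomorphism, omega_1 is the uncountable well-order all of
   whose proper initial segments are countable. *)
Definition is_omega1 : Prop :=
  [/\ well_order (<=%O : rel W),
      forall a : W, countable [set x : W | x < a]
    & ~ countable [set: W]].

(* The von Neumann identification of an ordinal [a] with the set of smaller
   ordinals. *)
Definition below (a : W) : set W := [set x | x < a].

Definition unbounded_in_order (C : set W) : Prop :=
  forall x, exists2 c, C c & x < c.

(* The condition on [a] says that [a] is a nonzero limit and [C] is cofinal in
   it; without [below a !=set0], it would hold vacuously for the ordinal 0. *)
Definition closed_in_order (C : set W) : Prop :=
  forall a, below a !=set0 ->
    (forall x, x < a -> exists2 c, C c & x < c < a) -> C a.

Definition club (C : set W) : Prop :=
  closed_in_order C /\ unbounded_in_order C.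

Definition stationary (S : set W) : Prop :=
  forall C, club C -> S `&` C !=set0.

Definition diamond_sequence (A : W -> set W) : Prop :=
  (forall a, A a `<=` below a) /\
  (forall B : set W, stationary [set a | B `&` below a = A a]).

End Omega1.

(* All orders satisfying [is_omega1] are isomorphic, so the choice of [W] is
   immaterial. *)
Definition diamond : Prop :=
  exists (d : Order.disp_t) (W : orderType d),
    is_omega1 W /\ exists A : W -> set W, diamond_sequence A.

Section Spaces.
Implicit Type X : topologicalType.

Definition scattered_space X : Prop :=
  forall A : set X, A !=set0 -> isolated A !=set0.

(* The library's [perfect_set] allows the empty set; by [perfectP] it means
   closed without isolated points. *)
Definition perfect X (P : set X) : Prop := P !=set0 /\ perfect_set P.

Definition weird X : Prop :=
  [/\ compact [set: X], ~ scattered_space X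
    & ~ exists P : set X, perfect P /\ totally_disconnected P].

Definition separable_space X : Prop := exists2 D : set X, countable D & dense D.

Definition lindelof_space X : Prop :=
  forall F : set (set X), F `<=` open -> \bigcup_(U in F) U = [set: X] ->
  exists G : set (set X),
    [/\ G `<=` F, countable G & \bigcup_(U in G) U = [set: X]].

(* Subspaces are the subtypes [set_type A] with the topology induced by the
   inclusion; the library's [subspace A] would keep the points outside [A] as
   isolated points. *)
Definition hereditarily (Q : topologicalType -> Prop) X : Prop :=
  forall A : set X, Q (set_type A).

End Spaces.

(* Main.v *)
(* The space X is a closed subspace of the cube [0, 1]^omega_1, cut out by one
   condition per coordinate a: either x agrees below a with a chosen point p_a,
   or x_a = f_a (x restricted below a), where f_a is continuous away from p_a.
   Stage a thus replaces at most one point of the space built so far by an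
   interval, so all fibres of the projections to initial coordinates are
   connected.  The diamond sequence predicts at stage a a closed set F_a of the
   space built so far.  The point p_a is chosen in F_a and not isolated in any
   F_b (b <= a) that contains it, and f_a oscillates so much on every such F_b
   near p_a that the whole interval over p_a lies in the closure of what is over
   F_b minus p_a.  Consequently, when F_b is the projection of a closed set C of
   X, every closed set with this projection contains the preimage of F_b, hence
   C itself is that preimage.  As every closed C is predicted somewhere, X is
   hereditarily separable and hereditarily Lindelof.  A perfect set P predicted
   at stage a either contains the connected fibre over p_a, or it has no
   admissible p_a; in that case its projection, being covered by countably many
   isolated points, has an isolated point itself, whose fibre is connected. *)
Require Import Defs.
From HB Require Import structures.
From mathcomp Require Import all_boot all_order all_algebra.
From mathcomp Require Import all_classical wochoice.
From mathcomp Require Import reals topology normedtype.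
From mathcomp Require Import lra Rstruct.

Set Implicit Arguments.
Unset Strict Implicit.
Unset Printing Implicit Defensive.

Import Order.TTheory GRing.Theory Num.Theory.
Import numFieldNormedType.Exports.
Local Open Scope classical_set_scope.
Local Open Scope ring_scope.

(** * Well-orders and omega_1 *)

Lemma countableU (T : Type) (A B : set T) :
  countable A -> countable B -> countable (A `|` B).
Proof.
move=> cA cB; rewrite -bigcup2E; apply: bigcup_countable => // i _.
by rewrite /bigcup2; case: eqP => // _; case: eqP => // _; exact: countable0.
Qed.

Lemma countable_image (T U : Type) (f : T -> U) (A : set T) :
  countable A -> countable (f @` A).
Proof. exact/sub_countable/card_image_le. Qed.

Section WellOrder.
Context {d : Order.disp_t} {W : orderType d}.
Hypothesis Wwo : well_order (<=%O : rel W).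

Definition upto (a : W) : set W := [set x | (x <= a)%O].

Lemma upto_below (a : W) : upto a = a |` below a.
Proof.
apply/seteqP; split=> x; rewrite /upto /below /= le_eqVlt.
  by case/orP => [/eqP|]; [left|right].
by case=> [->|->]; rewrite ?eqxx ?orbT.
Qed.

Lemma sub_below_upto (a b : W) : (a < b)%O -> upto a `<=` below b.
Proof. by move=> ab x /le_lt_trans; exact. Qed.

Lemma wo_min (A : set W) : A !=set0 ->
  exists m, A m /\ forall x, A x -> (m <= x)%O.
Proof.
case=> a Aa; have [|m [[Am mA] _]] := Wwo (A := [pred x | `[<A x>]]).
  by exists a; apply/asboolP.
exists m; split; first exact/asboolP.
by move=> x Ax; apply: mA; apply/asboolP.
Qed.

Lemma wo_wf : well_founded (fun x y : W => (x < y)%O).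
Proof.
move=> a; apply: contrapT => Na.
have [|m [Nm mP]] := wo_min (A := [set x | ~ Acc (fun x y : W => (x < y)%O) x]).
  by exists a.
apply: Nm; constructor=> y ym; apply: contrapT => /mP.
by rewrite leNgt ym.
Qed.

Lemma wo_rec (V : Type) (v0 : V) (step : W -> (W -> V) -> V) :
  (forall a g h, (forall b, below a b -> g b = h b) -> step a g = step a h) ->
  exists g, forall a, g a = step a g.
Proof.
move=> stepP.
(* [v0] fills in the values not yet defined; [stepP] makes the filling irrelevant. *)
pose F a (rec : forall b, (b < a)%O -> V) : V := step a (fun b =>
  match pselect (b < a)%O with left h => rec b h | right _ => v0 end).
exists (Fix wo_wf (fun=> V) F) => a.
rewrite Fix_eq; last first.
  by move=> x f g fg; apply: stepP => b ltbx; case: pselect.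
by apply: stepP => b ltba; case: pselect.
Qed.

End WellOrder.

(** * Countable bounds, coding of pairs and guessing in omega_1 *)

Section Omega1Facts.
Context {d : Order.disp_t} {W : orderType d}.
Hypothesis W1 : is_omega1 W.

Let Wwo : well_order (<=%O : rel W). Proof. by case: W1. Qed.

Lemma countable_below (a : W) : countable (below a).
Proof. by case: W1 => _ + _; apply. Qed.

Lemma countable_upto (a : W) : countable (upto a).
Proof.
by rewrite upto_below; apply/countableU => //; exact: countable_below.
Qed.

Lemma countable_bounded (A : set W) : countable A ->
  exists c, forall a, A a -> (a < c)%O.
Proof.
move=> cA; apply: contrapT => Nc; case: W1 => _ _; apply.
have -> : [set: W] = \bigcup_(a in A) upto a.
  rewrite eqEsubset; split=> // x _; apply: contrapT => Nx; apply: Nc; exists x.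
  by move=> a Aa; rewrite ltNge; apply/negP => xa; apply: Nx; exists a.
by apply: bigcup_countable => // a _; exact: countable_upto.
Qed.

Lemma omega1_bot : exists b : W, forall x, (b <= x)%O.
Proof.
have [|b [_ bP]] := wo_min Wwo (A := setT); last by exists b => x; exact: bP.
apply/set0P/negP => /eqP W0; case: W1 => _ _; apply; rewrite W0.
exact: countable0.
Qed.

(** Through such a [j], one subset of omega_1 codes a family of sets of naturals indexed by omega_1.
    The recursion never gets stuck: the earlier ranges have a countable union, whose complement is
    infinite. *)
Lemma omega1_pairing : exists j : W -> nat -> W,
  forall a n b m, j a n = j b m -> a = b /\ n = m.
Proof.
pose ok a (J : W -> nat -> W) (h : nat -> W) :=
  injective h /\ forall b n m, (b < a)%O -> h n <> J b m.
have okP a J : exists h, ok a J h.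
  pose B := \bigcup_(b in below a) range (J b).
  have cB : countable B.
    apply: bigcup_countable; first exact: countable_below.
    by move=> b _; apply: countable_image.
  have /infiniteP /card_leP[h] : infinite_set (~` B).
    move=> fB; case: W1 => _ _; apply; rewrite -(setvU B).
    by apply/countableU => //; exact: finite_set_countable.
  exists (fun n => val (h (to_setT n))); split.
    move=> n m /val_inj /inj.
    by rewrite !inE => /(_ I I) /(congr1 val).
  move=> b n m ba E.
  have /set_mem := valP (h (to_setT n)).
  by apply; rewrite [X in B X]E; exists b.
have [b0 _] := omega1_bot.
have [|j jP] := wo_rec Wwo (fun=> b0)
  (step := fun a J => xget (fun=> b0) (ok a J)).
  move=> a J J' JJ'; congr xget; apply/funext => h; apply/propext.
  by split=> -[hi hb]; split=> // b n m ba;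
    [rewrite -JJ'|rewrite JJ'] => //; exact: hb.
have {}jP a : ok a j (j a).
  by rewrite jP; have [h hP] := okP a j; exact: (xgetPex _ (ex_intro _ h hP)).
exists j => a n b m E; have [ab|ba|ab] := ltgtP a b.
- by case: (jP b) => _ /(_ a m n ab); rewrite E.
- by case: (jP a) => _ /(_ b n m ba); rewrite E.
- by subst b; split=> //; case: (jP a) => ji _; exact: ji.
Qed.

(** For unboundedness, a bound [next] of all earlier values is iterated along the naturals, and [g]
    is the least strict upper bound of the iterates. *)
Lemma club_closure_points (j : W -> nat -> W) :
  club [set g : W | below g !=set0 /\ forall a n, below g a -> below g (j a n)].
Proof.
split=> [g g0 gC|x].
  split=> // a n /gC[c [_ cC] /andP[ac cg]].
  exact: lt_trans (cC _ n ac) cg.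
have nextP (y : W) : exists z, (y < z)%O /\ forall a n, (a <= y)%O -> (j a n < z)%O.
  have [|z zP] := countable_bounded (A := y |` \bigcup_(a in upto y) range (j a)).
    apply: countableU => //; apply: bigcup_countable; first exact: countable_upto.
    by move=> a _; exact: countable_image.
  exists z; split=> [|a n ay]; first by apply: zP; left.
  by apply: zP; right; exists a => //; exists n.
have [next nextE] := choice nextP.
pose s n := iter n next x.
have [|g [sg gmin]] := wo_min Wwo (A := [set g | forall n, (s n < g)%O]).
  have [|c cP] := countable_bounded (A := range s); first exact: countable_image.
  by exists c => n; apply: cP; exists n.
exists g; last exact: (sg 0).
split=> [|a n ag]; first by exists x; exact: (sg 0).
have [m am] : exists m, (a <= s m)%O.
  apply: contrapT => Nm; move: ag; rewrite /below /= ltNge gmin // => m.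
  by rewrite ltNge; apply/negP => am; apply: Nm; exists m.
by apply: lt_trans (sg m.+1); case: (nextE (s m)) => _; exact.
Qed.

(** The guess is taken at a closure point [g] of [j]: there the code of a pair with first entry
    below [g] is itself below [g], so cutting the coded set at [g] loses none of these pairs. *)
Lemma diamond_guess (A : W -> set W) (j : W -> nat -> W) :
  diamond_sequence A ->
  (forall a n b m, j a n = j b m -> a = b /\ n = m) ->
  forall B : W -> nat -> Prop, exists g, below g !=set0 /\
    forall a n, below g a -> A g (j a n) <-> B a n.
Proof.
move=> [_ AS] jI B.
pose B' : set W := [set w | exists a n, w = j a n /\ B a n].
have [g [/= BA [g0 gC]]] := AS B' _ (club_closure_points j).
exists g; split=> // a n ag; rewrite -BA; split.
  by case=> -[a' [n' [/jI[-> ->]]]].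
by move=> Ban; split; [exists a, n|exact: gC].
Qed.

End Omega1Facts.

(** * Oscillating functions on the line *)

Section Oscillation.
Context {R : realType}.

Section Tents.
Variables (u q : nat -> R).
Hypothesis u_gap : forall n, u n + 2 < u n.+1.
Hypothesis u0_gt0 : 0 < u 0.
Hypothesis q01 : forall n, 0 <= q n <= 1.

Let tent n x := q n * Num.max 0 (1 - `|x - u n|).
Let S N x := \sum_(i < N) tent i x.
(** As [u n] exceeds [n], the tents from index [nb x] on vanish at [x], so the sum is locally
    finite. *)
Let nb (x : R) := Num.bound (`|x| + 1).
Let g x := Num.min 1 (S (nb x) x).

Let u_gt n : n%:R < u n.
Proof.
elim: n => [//|n IH]; apply: lt_trans (u_gap n).
by rewrite -natr1; lra.
Qed.

Let tent0 n x : 1 <= `|x - u n| -> tent n x = 0.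
Proof.
by move=> h; rewrite /tent (max_idPl _) ?mulr0 // subr_le0.
Qed.

Let S_stable N x : `|x| + 1 <= N%:R -> S N x = S (nb x) x.
Proof.
have tailE M M' : (M <= M')%N -> `|x| + 1 <= M%:R -> S M' x = S M x.
  move=> /subnKC <- xM; rewrite /S big_split_ord /= [X in _ + X]big1 ?addr0 //.
  move=> i _; apply: tent0; have := u_gt (M + i).
  rewrite natrD => uM; have := ler0n R i.
  by rewrite distrC => i0; have := ler_norm x; have := ler_norm (u (M + i) - x);
     move: xM uM; lra.
move=> xN; have [/tailE->//|/ltnW/tailE->//] := leqP N (nb x).
by apply/ltW/archi_boundP; rewrite addr_ge0.
Qed.

Let tent_continuous n : continuous (tent n).
Proof.
move=> x; apply: cvgM; first exact: cvg_cst.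
apply: (@continuous_max R R (cst 0) (fun y => 1 - `|y - u n|)).
  exact: cvg_cst.
apply: cvgB; first exact: cvg_cst.
by apply: cvg_norm; apply: cvgB; [exact: cvg_id|exact: cvg_cst].
Qed.

Let S_continuous N : continuous (S N).
Proof.
elim: N => [|N IH] x.
  rewrite (_ : S 0 = cst 0); first exact: cvg_cst.
  by apply/funext => y; rewrite /S big_ord0.
rewrite (_ : S N.+1 = (fun y => S N y + tent N y)).
  by apply: cvgD; [exact: IH|exact: tent_continuous].
by apply/funext => y; rewrite /S big_ord_recr.
Qed.

Lemma tents : exists f : R -> R, [/\ continuous f, forall x, 0 <= f x <= 1
  & forall n, f (u n) = q n].
Proof.
exists g; split=> [x|x|n].
- pose N := Num.bound (`|x| + 2).
  have gE : \forall y \near x, Num.min 1 (S N y) = g y.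
    near=> y; rewrite /g (@S_stable N) //.
    have : `|x| + 2 < N%:R by apply: archi_boundP; rewrite addr_ge0.
    have : `|x - y| < 1 by near: y; apply: cvgr_dist_lt.
    have := ler_normD (y - x) x; rewrite subrK (distrC y x); lra.
  apply: cvg_trans (near_eq_cvg gE) _; rewrite -(nbhs_singleton gE).
  by apply: (@continuous_min R R (cst 1) (S N)); [exact: cvg_cst|exact: S_continuous].
- rewrite /g le_min ler01 ge_min lexx andbT /=; apply: sumr_ge0 => i _.
  by apply: mulr_ge0; [case/andP: (q01 i)|rewrite le_max lexx].
- have far m k : u m + 1 <= u (m + k.+1).
    elim: k => [|k IH]; first by rewrite addn1; have := u_gap m; lra.
    by rewrite addnS; have := u_gap (m + k.+1); lra.
  pose N := (maxn (nb (u n)) n.+1).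
  have nN : (n < N)%N by rewrite /N leq_max leqnn orbT.
  rewrite /g -(@S_stable N); last first.
    apply: le_trans (_ : (nb (u n))%:R <= _).
      by apply/ltW/archi_boundP; rewrite addr_ge0.
    by rewrite ler_nat leq_maxl.
  rewrite /S (bigD1 (Ordinal nN)) //= big1 ?addr0 => [|i ni]; last first.
    apply: tent0; have [ltin|ltni|E] := ltngtP i n.
    - rewrite ger0_norm; have := far i (n - i).-1;
      by rewrite prednK ?subn_gt0 // subnKC ?(ltnW ltin) //; lra.
    - rewrite distrC ger0_norm; have := far n (i - n).-1;
      by rewrite prednK ?subn_gt0 // subnKC ?(ltnW ltni) //; lra.
    - by case/eqP: ni; apply: val_inj.
  rewrite /tent subrr normr0 subr0 (max_idPr ler01) mulr1.
  by apply/min_idPr; case/andP: (q01 n).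
Unshelve. all: by end_near.
Qed.

End Tents.

Lemma rat_approx (r e : R) : 0 < e -> exists t : rat, `|ratr t - r| < e.
Proof.
move=> e0; have [t] := @rat_in_itvoo R (r - e) (r + e) ltac:(lra).
by rewrite in_itv /= => /andP[t1 t2]; exists t; rewrite ltr_norml; lra.
Qed.

Lemma inv_nat_le (e : R) : 0 < e -> exists n, n.+1%:R^-1 <= e.
Proof.
move=> e0; exists (Num.bound e^-1); rewrite -[leRHS]invrK lef_pV2 ?posrE ?invr_gt0 //.
apply: ltW; apply: lt_le_trans (archi_boundP _) _; first by rewrite invr_ge0 ltW.
by rewrite ler_nat.
Qed.

(** A triple of an index [k], a bound [m] and a rational [t] is a request to visit [D k] beyond [m]
    with value near [t]. The requests are enumerated, met in turn at points more than 2 apart, and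
    interpolated by [tents]. *)
Lemma oscillation (D : nat -> set R) :
  (forall k M, exists u, D k u /\ M < u) ->
  exists f : R -> R, [/\ continuous f, forall x, 0 <= f x <= 1
  & forall k r M e, 0 <= r <= 1 -> 0 < e ->
      exists u, [/\ D k u, M < u & `|f u - r| < e]].
Proof.
move=> Dinf.
have /choice[pick pickP] (p : nat * R) : exists u, D p.1 u /\ p.2 < u.
  exact: Dinf.
pose req n : nat * nat * rat := odflt (0%N, 0%N, 0) (choice.unpickle n).
(* Clamping to the unit interval does not increase the distance to an [r] in it. *)
pose q n : R := Num.max 0 (Num.min 1 (ratr (req n).2)).
pose fix u n := match n with
  | 0 => pick ((req 0).1.1, Num.max 0 (req 0).1.2%:R)
  | m.+1 => pick ((req m.+1).1.1, Num.max (u m + 2) (req m.+1).1.2%:R) end.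
have [||n|f [fc f01 fu]] := @tents u q.
- by move=> n; case: (pickP ((req n.+1).1.1, Num.max (u n + 2) (req n.+1).1.2%:R));
    rewrite gt_max => _ /andP[].
- by case: (pickP ((req 0).1.1, Num.max 0 (req 0).1.2%:R)); rewrite gt_max => _ /andP[].
- by rewrite /q le_max lexx ge_max ler01 ge_min lexx.
have uD n : D (req n).1.1 (u n) /\ (req n).1.2%:R < u n.
  case: n => [|n].
    by case: (pickP ((req 0).1.1, Num.max 0 (req 0).1.2%:R)); rewrite gt_max => ? /andP[].
  by case: (pickP ((req n.+1).1.1, Num.max (u n + 2) (req n.+1).1.2%:R));
    rewrite gt_max => ? /andP[].
exists f; split=> // k r M e /andP[r0 r1] e0.
have [t rt] := rat_approx r e0.
pose n := choice.pickle (k, Num.bound `|M|, t).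
have reqE : req n = (k, Num.bound `|M|, t) by rewrite /req choice.pickleK.
exists (u n); have [Dn nM] := uD n; split.
- by move: Dn; rewrite reqE.
- apply: lt_trans nM; rewrite reqE /=; apply: le_lt_trans (ler_norm M) _.
  exact: archi_boundP.
- rewrite fu /q reqE /=; apply: le_lt_trans rt.
  have := ler_norm (ratr t - r); have := ler_norm (r - ratr t : R).
  rewrite distrC => h1 h2.
  rewrite ler_norml; case: (leP 1 (ratr t)) => t1; last case: (leP 0 (ratr t)) => t0;
    rewrite ?(max_idPr ler01); apply/andP; split; lra.
Qed.

End Oscillation.

(** * Blowing up a point of a cube *)

Section Cube.
Context {R : realType} {W : choiceType}.
Local Notation T := (prod_topology (fun _ : W => R)).
Implicit Types (x y z p : W -> R) (S : set W) (E : seq W).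

Definition agree S x y := forall i, S i -> x i = y i.

Definition close_on E (e : R) x y := forall i, i \in E -> `|x i - y i| < e.

(* [p] is a limit of points of [A] in the projection to the coordinates in [S]. *)
Definition nonisolated S (A : set (W -> R)) p :=
  forall E e, [set` E] `<=` S -> 0 < e ->
    exists z, [/\ A z, ~ agree S z p & close_on E e z p].

Lemma agreeS S S' x y : S `<=` S' -> agree S' x y -> agree S x y.
Proof. by move=> SS' xy i /SS'; exact: xy. Qed.

Lemma agreeC S x y : agree S x y -> agree S y x.
Proof. by move=> xy i /xy. Qed.

Lemma agree_trans S x y z : agree S x y -> agree S y z -> agree S x z.
Proof. by move=> xy yz i Si; rewrite xy // yz. Qed.

Lemma continuous_coord i : continuous (fun x : T => x i).
Proof. exact: (@proj_continuous W (fun=> R) i). Qed.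

Lemma nbhs_close_on (x : T) E e : 0 < e -> nbhs x [set y : T | close_on E e x y].
Proof.
move=> e0; elim: E => [|i E IH]; first by apply: filterS filterT => y _ i.
have /cvgrPdist_lt/(_ e e0) hi := @continuous_coord i x.
apply: filterS (filterI hi IH) => y [xyi xyE] k; rewrite inE.
by case/orP => [/eqP->//|]; exact: xyE.
Qed.

Section Gauge.
Variables (S : set W) (p : W -> R).

(** The weight is [1/(n+1)] at the element of [S] numbered [n] and 0 off [S]. As only finitely many
    weights reach a given [e], suprema of bounded terms with these weights are continuous for the
    product topology. *)
Lemma countable_weight : countable S -> exists w : W -> R,
  [/\ forall i, 0 <= w i <= 1, forall i, 0 < w i <-> S i
    & forall e, 0 < e -> exists E, [set` E] `<=` S /\
        forall i, e <= w i -> i \in E].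
Proof.
move=> /countable_injP[f finj].
pose w i : R := if i \in S then (f i).+1%:R^-1 else 0.
have wS i : 0 < w i <-> S i.
  rewrite /w; case: ifPn => [/set_mem Si|/negP NSi].
    by split=> // _; rewrite invr_gt0.
  by rewrite ltxx; split=> // Si; case: NSi; exact: mem_set.
exists w; split=> // [i|e e0].
  rewrite /w; case: ifP => _; last by rewrite lexx ler01.
  by rewrite invr_ge0 ler0n invf_le1 // ler1n.
pose B := [set i | e <= w i].
have BS : B `<=` S by move=> i /(lt_le_trans e0)/wS.
have /finite_seqP[E BE] : finite_set B.
  have fin : finite_set (f @` B).
    apply: sub_finite_set (finite_II (Num.bound e^-1)) => n /= [i Bi <-].
    rewrite -(ltr_nat R); apply: le_lt_trans (archi_boundP _); last first.
      by rewrite invr_ge0 ltW.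
    have /mem_set Si := BS _ Bi; move: Bi; rewrite /B /= /w Si => ei.
    apply: (@le_trans _ _ (f i).+1%:R); first by rewrite ler_nat.
    by rewrite -[leLHS]invrK lef_pV2 ?posrE ?invr_gt0.
  have /inj_card_eq/card_eqPle[_] : {in B &, injective f}.
    by move=> i k /set_mem/BS/mem_set iB /set_mem/BS/mem_set kB; exact: finj.
  by move=> /card_le_finite; exact.
exists E; rewrite -BE; split=> // i ei.
by have : [set` E] i by rewrite -BE.
Qed.

(* The values of [h] are the distances to [p] in a metric for the countable
   power of the line indexed by [S]. *)
Lemma gauge : countable S -> exists h : T -> R,
  [/\ continuous h,
      forall x, 0 <= h x,
      forall x, h x = 0 <-> agree S x p,
      forall x y, agree S x y -> h x = h y
    & (forall E e, [set` E] `<=` S -> 0 < e ->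
        exists2 t, 0 < t & forall x, h x < t -> close_on E e x p) /\
      forall t, 0 < t -> exists E e, [/\ [set` E] `<=` S, 0 < e &
        forall x, close_on E e x p -> h x < t]].
Proof.
move=> /countable_weight[w [w01 wS wfin]].
(* The extra index [None] contributes 0, which keeps the supremum nonnegative and over a nonempty
   set. *)
pose a x (o : option W) := if o is Some i then w i * Num.min 1 `|x i - p i| else 0.
pose h x := sup (range (a x)).
have a_le x i : a x (Some i) <= 1.
  have /andP[wi0 wi1] := w01 i.
  by apply: mulr_ile1 => //; rewrite ?le_min ?ler01 ?normr_ge0 // ge_min lexx.
have a_ge0 x i : 0 <= a x (Some i).
  have /andP[wi0 wi1] := w01 i.
  by apply: mulr_ge0; rewrite // le_min ler01 normr_ge0.
have h_ub x o : a x o <= h x.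
  apply: ub_le_sup; last by exists o.
  by exists 1 => _ [[i|] _ <-]; [exact: a_le|exact: ler01].
have h_le x c : 0 <= c -> (forall i, a x (Some i) <= c) -> h x <= c.
  move=> c0 ac; apply: ge_sup; first by exists (a x None), None.
  by move=> _ [[i|] _ <-].
have h_ge0 x : 0 <= h x by exact: (h_ub x None).
have h_unif e : 0 < e -> exists E, [set` E] `<=` S /\
    forall x y, close_on E e x y -> h x <= h y + e.
  move=> e0; have [E [ES EP]] := wfin _ e0; exists E; split=> // x y xy.
  apply: h_le => [|i]; first by rewrite addr_ge0 // ltW.
  apply: le_trans (_ : a y (Some i) + e <= _); last by rewrite lerD2r.
  have /andP[wi0 wi1] := w01 i.
  have [wie|/EP/xy xyi] := ltP (w i) e.
    apply: le_trans (_ : e <= _); last by rewrite lerDr.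
    rewrite (le_trans _ (ltW wie)) // ler_piMr // ge_min lexx //.
  have le : Num.min 1 `|x i - p i| <= Num.min 1 `|y i - p i| + `|x i - y i|.
    have := ler_normD (x i - y i) (y i - p i); rewrite subrKA.
    have := normr_ge0 (x i - y i).
    by case: (leP 1 `|x i - p i|); case: (leP 1 `|y i - p i|); lra.
  apply: le_trans (ler_wpM2l wi0 le) _; rewrite mulrDr lerD2l.
  by apply: le_trans (ltW xyi); rewrite ler_piMl.
have w_eq0 i : ~ S i -> w i = 0.
  move=> NSi; have /andP[wi0 _] := w01 i; apply/eqP; rewrite eq_le wi0 andbT.
  by rewrite leNgt; apply/negP => /wS.
have h_eq0 x : h x = 0 <-> agree S x p.
  split=> [hx0 i Si|xp].
    have wi0 : 0 < w i by apply/wS.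
    have := h_ub x (Some i); rewrite hx0 /= pmulr_rle0 // ge_min ler10 /=.
    by rewrite normr_le0 subr_eq0 => /eqP.
  apply/eqP; rewrite eq_le h_ge0 andbT; apply: h_le => // i /=.
  have [/xp->|/w_eq0->] := pselect (S i); last by rewrite mul0r.
  by rewrite subrr normr0 (min_idPr ler01) mulr0.
exists h; split=> // [x|x y xy|]; last split=> [E e ES e0|t t0].
- apply/(@cvgrPdist_le R R T (nbhs x) _ h (h x)) => e e0; have [E [_ EP]] := h_unif _ e0.
  near=> y.
  have xy : close_on E e x y by near: y; exact: nbhs_close_on.
  have yx : close_on E e y x by move=> i /xy; rewrite distrC.
  by rewrite ler_norml; have := EP _ _ xy; have := EP _ _ yx; lra.
- rewrite /h (_ : a x = a y) //; apply/funext => -[i|//] /=.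
  by have [/xy->|/w_eq0->] := pselect (S i); rewrite ?mul0r.
- elim: E ES => [|i E IH] ES; first by exists 1.
  have [|t t0 tP] := IH; first by move=> k kE; apply: ES; rewrite /= inE kE orbT.
  have Si : S i by apply: ES; rewrite /= inE eqxx.
  have wi0 : 0 < w i by apply/wS.
  exists (Num.min t (w i * Num.min 1 e)).
    by rewrite lt_min t0 mulr_gt0 // lt_min ltr01.
  move=> x; rewrite lt_min => /andP[/tP xE hi] k; rewrite inE => /orP[/eqP->|/xE //].
  have := le_lt_trans (h_ub x (Some i)) hi; rewrite /= ltr_pM2l //.
  by rewrite lt_min !gt_min ltxx /= => /andP[x1 /orP[|//]]; exact: lt_trans.
- have [E [ES EP]] := h_unif _ (divr_gt0 t0 (ltr0n R 2)).
  exists E, (t / 2); split=> // [|x /EP]; first by rewrite divr_gt0.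
  by rewrite (_ : h p = 0) ?add0r => [|//]; [lra|exact/h_eq0].
Unshelve. all: by end_near.
Qed.

(** The function is [g (h x)^-1], where [h] is the gauge at [p] and [g] oscillates at infinity.
    Nonisolation of [p] makes [1/h] unbounded on the points of [Y] and [B] off the class of [p],
    which is what [oscillation] asks for. *)
Lemma blowup (Y : set (W -> R)) (K : set (set (W -> R))) :
  countable S -> countable K ->
  (forall B, K B -> B p -> nonisolated S (Y `&` B) p) ->
  exists f : (W -> R) -> R,
  [/\ forall x y, agree S x y -> f x = f y,
      forall x, 0 <= f x <= 1,
      forall i, closed [set x : T | agree S x p \/ x i = f x]
    & forall B, K B -> B p ->
      forall r E e, 0 <= r <= 1 -> [set` E] `<=` S -> 0 < e ->
      exists z, [/\ Y z, B z, ~ agree S z p, close_on E e z p & `|f z - r| < e]].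
Proof.
move=> cS /countable_injP[k kinj] Knon.
have [h [hc h0 hP hS [h_close h_small]]] := gauge cS.
(* An index that numbers no relevant [B] yields the whole line, so every [D n] is unbounded. *)
pose D n : set R := [set u | forall B, K B -> B p -> k B = n ->
  exists z, [/\ Y z, B z, ~ agree S z p & u = (h z)^-1]].
have hN0 z : ~ agree S z p -> 0 < h z.
  by move=> zp; rewrite lt_def h0 andbT; apply/eqP => /hP.
have Dinf n M : exists u, D n u /\ M < u.
  have [[B [KB Bp kB]]|noB] := pselect (exists B, [/\ K B, B p & k B = n]).
    have M0 : 0 < `|M| + 1 by rewrite ltr_wpDl.
    have [|E [e [ES e0 Eh]]] := h_small (`|M| + 1)^-1; first by rewrite invr_gt0.
    have [z [[Yz Bz] zp zE]] := Knon B KB Bp E e ES e0.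
    exists (h z)^-1; split.
      move=> B' KB' B'p kB'; exists z; split=> //.
      by rewrite (kinj B' B) ?inE // kB.
    apply: le_lt_trans (ler_norm M) _; apply: (@lt_trans _ _ (`|M| + 1)).
      by rewrite ltrDl.
    by rewrite -[ltLHS]invrK ltf_pV2 ?posrE ?invr_gt0 ?hN0 //; exact: Eh.
  exists (M + 1); split; last by rewrite ltrDl.
  by move=> B KB Bp kB; case: noB; exists B.
have [g [gc g01 gosc]] := oscillation Dinf.
exists (fun x => g (h x)^-1); split=> [x y /hS->//|x|i|B KB Bp r E e r01 ES e0].
- exact: g01.
(* Off the class of [p] the gauge is nonzero, so the new function is continuous there and both
   negated equations are open conditions. *)
- rewrite -openC openE => x /= Nx; rewrite /interior.
  have hx0 : h x != 0 by apply/eqP => /hP ?; apply: Nx; left.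
  have fx0 : x i - g (h x)^-1 != 0.
    by rewrite subr_eq0; apply/eqP => ?; apply: Nx; right.
  have fc : (fun y : T => y i - g (h y)^-1) @ x --> x i - g (h x)^-1.
    apply: (@cvgB R R T (nbhs x) _ (fun y => y i) (fun y => g (h y)^-1)).
      exact: continuous_coord.
    apply: (@continuous_cvg _ _ _ (nbhs x) _ (fun y => (h y)^-1) g).
      exact: gc.
    by apply: (@cvgV R T (nbhs x) _ h (h x)) => //; exact: hc.
  have hn := @cvgr_neq0 R R T (nbhs x) (nbhs_filter x) h (h x) (hc x) hx0.
  have fn := @cvgr_neq0 R R T (nbhs x) (nbhs_filter x) _ _ fc fx0.
  apply: (@filterS _ _ (nbhs_filter x) _ _ _ (filterI hn fn)) => y [hy fy] [/hP/eqP|/eqP].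
    exact/negP.
  by rewrite -subr_eq0; exact/negP.
- have [t t0 tP] := h_close _ _ ES e0.
  have [_ [/(_ B KB Bp erefl)[z [Yz Bz zp ->]] tz gz]] := gosc (k B) r t^-1 e r01 e0.
  exists z; split=> //; apply: tP.
  by move: tz; rewrite ltf_pV2 ?posrE ?hN0.
Qed.

End Gauge.
End Cube.

(** * The tower of stages *)

Section Tower.
Context {R : realType} {d : Order.disp_t} {W : orderType d}.
Local Notation T := (prod_topology (fun _ : W => R)).
Implicit Types (x y z : W -> R) (a b : W) (S : set W) (E : seq W) (r e : R).

Record stage := Stage {
  active : Prop;
  centre : W -> R;
  value : (W -> R) -> R }.

Implicit Type s : W -> stage.

Definition rule s a x : Prop :=
  (active (s a) /\ agree (below a) x (centre (s a))) \/ x a = value (s a) x.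

(** All stages share one cube: [fits s (below a)] serves as the cylinder over the space built before
    [a], with later coordinates free in the unit interval. *)
Definition fits s (S : set W) x : Prop :=
  (forall i, 0 <= x i <= 1) /\ forall a, S a -> rule s a x.

Variable F : W -> set (W -> R).

(* The first stage creates the interval [0, 1], so it ignores the prediction
   [F]. *)
Definition target a : set (W -> R) := [set x | below a !=set0 -> F a x].

Definition predicted a : set (set (W -> R)) :=
  F @` [set b | below b !=set0 /\ upto a b].

Definition admissible (Y : set (W -> R)) a p : Prop :=
  [/\ Y p, target a p & forall B, predicted a B -> B p ->
      nonisolated (below a) (Y `&` B) p].

(** The fourth clause drives the irreducibility of projections. The last, by which a stage is idle
    only for want of an admissible point, makes the bottom stage active and excludes totally
    disconnected perfect sets. *)
Definition good_stage (Y : set (W -> R)) a (t : stage) : Prop :=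
  [/\ forall x y, agree (below a) x y -> value t x = value t y,
      forall x, 0 <= value t x <= 1,
      closed [set x : T | (active t /\ agree (below a) x (centre t)) \/
                          x a = value t x],
      active t -> [/\ Y (centre t), target a (centre t)
        & forall B, predicted a B -> B (centre t) ->
          forall r E e, 0 <= r <= 1 -> [set` E] `<=` below a -> 0 < e ->
          exists z, [/\ Y z, B z, ~ agree (below a) z (centre t),
                        close_on E e z (centre t) & `|value t z - r| < e]]
    & ~ active t -> forall p, ~ admissible Y a p].

Hypothesis W1 : is_omega1 W.

Let Wwo : well_order (<=%O : rel W). Proof. by case: W1. Qed.

Lemma countable_predicted a : countable (predicted a).
Proof.
apply/countable_image/(sub_countable _ (countable_upto W1 a)).
by apply: subset_card_le => b [].
Qed.

Lemma good_stage_exists Y a : exists t, good_stage Y a t.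
Proof.
have [[p [Yp tp np]]|Np] := pselect (exists p, admissible Y a p).
  have [f [fS f01 fc fP]] :=
    blowup (countable_below W1 a) (countable_predicted a) np.
  exists (Stage True p f); split=> //=.
  by rewrite (_ : mkset _ = [set x : T | agree (below a) x p \/ x a = f x]) //;
    apply/seteqP; split=> x /=; tauto.
exists (Stage False (fun=> 0) (fun=> 0)); split=> //=.
- by move=> x; rewrite lexx ler01.
- rewrite (_ : mkset _ = (fun x : T => x a) @^-1` [set (0 : R)]).
    by apply: closed_comp => [x _|]; [exact: continuous_coord|exact: closed_eq].
  by apply/seteqP; split=> x /=; tauto.
- by move=> _ p ap; apply: Np; exists p.
Qed.

Lemma tower : exists s, forall a, good_stage (fits s (below a)) a (s a).
Proof.
pose t0 := Stage False (fun=> 0) (fun=> 0).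
pose pick Y a := sval (cid (good_stage_exists Y a)).
have [|s sP] := wo_rec Wwo t0 (step := fun a s => pick (fits s (below a)) a).
  move=> a s s' ss'; congr pick; apply/funext => x.
  by apply/propext; split=> -[x01 xr]; split=> // b ba; have := xr b ba;
    rewrite /rule ss'.
by exists s => a; rewrite sP; exact: svalP.
Qed.

Section Extension.
Variable s : W -> stage.
Hypothesis sP : forall a, good_stage (fits s (below a)) a (s a).

Lemma rule_agree a x y : agree (upto a) x y -> rule s a x -> rule s a y.
Proof.
rewrite upto_below => xy; have xa : x a = y a by apply: xy; left.
have xby : agree (below a) x y by apply: agreeS xy => b; right.
case=> [[oa xc]|E]; [left|right].
  by split=> //; apply: agree_trans xc; exact: agreeC.
by rewrite -xa E; case: (sP a) => + _ _ _ _; exact.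
Qed.

Lemma fits_agree S x y : (forall i, 0 <= y i <= 1) ->
  (forall a, S a -> upto a `<=` S) -> agree S x y -> fits s S x -> fits s S y.
Proof.
move=> y01 SS xy [_ xr]; split=> // a Sa.
by apply: rule_agree (xr a Sa); apply: agreeS xy; exact: SS.
Qed.

(** Setting each coordinate outside [S] to its [value] obeys every rule, whether or not the stage is
    active. *)
Lemma fits_extend S x : (forall a, S a -> upto a `<=` S) -> fits s S x ->
  exists y, fits s setT y /\ agree S y x.
Proof.
move=> SS [x01 xr].
have [|y yP] := wo_rec Wwo (0 : R)
  (step := fun a g => if a \in S then x a else value (s a) g).
  by move=> a g h gh; case: ifP => // _; case: (sP a) => + _ _ _ _; exact.
have yx : agree S y x by move=> a /mem_set Sa; rewrite yP Sa.
exists y; split=> //; split=> [a|a _].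
  by rewrite yP; case: ifP => _ //; case: (sP a) => _ + _ _ _; exact.
have [/set_mem Sa|NSa] := boolP (a \in S).
  by apply: rule_agree (xr a Sa); apply: agreeC; apply: agreeS yx; exact: SS.
by right; rewrite {1}yP (negbTE NSa).
Qed.

(** Over [centre] the rule leaves coordinate [a] free; later coordinates come from [fits_extend]. *)
Lemma fits_blowup a r : active (s a) -> 0 <= r <= 1 ->
  exists y, [/\ fits s setT y, agree (below a) y (centre (s a)) & y a = r].
Proof.
move=> oa r01; have [_ _ _ /(_ oa)[pY _ _] _] := sP a.
pose x i := if i == a then r else centre (s a) i.
have xp : agree (below a) x (centre (s a)).
  by move=> i ia; rewrite /x (lt_eqF ia).
have x01 i : 0 <= x i <= 1 by rewrite /x; case: eqP => // _; case: pY.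
have [b /= ba|_ xb] := fits_agree x01 _ (agreeC xp) pY.
  by apply: sub_below_upto.
have [b||y [yf yx]] := @fits_extend (upto a) x.
- by move=> ba i /le_trans; exact.
- split=> // b; rewrite upto_below => -[->|/xb//]; by left.
exists y; split=> //; last by rewrite yx /upto /= ?lexx // /x eqxx.
by apply: agree_trans xp; apply: agreeS yx => i /ltW.
Qed.

End Extension.
End Tower.

(** * Finite approximation and boxes *)

Lemma compact_family (Y : topologicalType) (K : set Y) (I : choiceType)
    (f : I -> set Y) :
  compact K -> (forall i, closed (f i)) ->
  (forall s : seq I, exists y, K y /\ forall i, i \in s -> f i y) ->
  exists y, K y /\ forall i, f i y.
Proof.
move=> Kc fc fin.
pose F : set_system Y := filter_from setT
  (fun s : seq I => [set y | K y /\ forall i, i \in s -> f i y]).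
have FF : ProperFilter F.
  apply: filter_from_proper => [|s _]; last exact: fin.
  apply: filter_from_filter => [|s t _ _]; first by exists [::].
  exists (s ++ t) => // y [Ky yf].
  by split; split=> // i iE; apply: yf; rewrite mem_cat iE ?orbT.
have [|y [Ky yF]] := Kc F FF; first by exists [::] => // y [].
exists y; split=> // i; apply: (fc i) => B yB.
have [||z [fz Bz]] := yF (f i) B; last by exists z.
- by exists [:: i] => // z [_]; apply; rewrite inE.
- exact: yB.
Qed.

Section Approximation.
Context {R : realType} {W : choiceType} {Y : topologicalType}.
Variables (K : set Y) (phi psi : Y -> W -> R).
Hypothesis Kc : compact K.
Hypothesis phic : forall i, continuous (fun y => phi y i).
Hypothesis psic : forall i, continuous (fun y => psi y i).

(** Agreement is an intersection of closed conditions, one for each coordinate and tolerance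
    [1/(n+1)]; a single approximation meets any finite number of them. *)
Lemma approx_agree (S : set W) :
  (forall (E : seq W) (e : R), [set` E] `<=` S -> 0 < e ->
    exists y, K y /\ close_on E e (phi y) (psi y)) ->
  exists y, K y /\ agree S (phi y) (psi y).
Proof.
move=> app.
pose f (p : W * nat) : set Y :=
  [set y | S p.1 -> `|phi y p.1 - psi y p.1| <= p.2.+1%:R^-1].
have fc p : closed (f p).
  have [Sp|NSp] := pselect (S p.1); last first.
    rewrite (_ : f p = setT); first exact: closedT.
    by apply/seteqP; split=> // y _ /NSp.
  rewrite (_ : f p = (fun y => `|phi y p.1 - psi y p.1|) @^-1`
      [set r : R | r <= p.2.+1%:R^-1]); last first.
    by apply/seteqP; split=> y /=; [exact|move=> ? _].
  apply: closed_comp => [y _|]; last exact: closed_le.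
  apply: (@cvg_norm R R Y (nbhs y) _ (fun y => phi y p.1 - psi y p.1)).
  by apply: (@cvgB R R Y (nbhs y) _ (fun y => phi y p.1) (fun y => psi y p.1));
    [exact: phic|exact: psic].
have [s|y [Ky yf]] := compact_family Kc fc.
  pose E := [seq p.1 | p <- s & `[< S p.1 >]].
  have ES : [set` E] `<=` S.
    by move=> i /= /mapP[p]; rewrite mem_filter => /andP[/asboolP Sp _] ->.
  pose N := (\max_(p <- s) p.2)%N.
  have [|y [Ky yE]] := app E N.+1%:R^-1 ES; first by rewrite invr_gt0.
  exists y; split=> // p ps Sp.
  have /yE/ltW/le_trans : p.1 \in E.
    by apply: map_f; rewrite mem_filter ps andbT; exact/asboolP.
  apply; rewrite lef_pV2 ?posrE ?ltr0n // ler_nat ltnS.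
  by rewrite /N (big_rem p ps) /= leq_maxl.
exists y; split=> // i Si; apply/eqP; rewrite -subr_eq0 -normr_le0.
apply/ler_addgt0Pr => e e0; rewrite add0r.
have [n ne] := inv_nat_le e0.
by apply: le_trans ne; exact: (yf (i, n)).
Qed.

End Approximation.

Lemma seq_upto {d : Order.disp_t} {W : orderType d} (S : set W) (E : seq W) :
  [set` E] `<=` S -> E = [::] \/ exists b, S b /\ [set` E] `<=` upto b.
Proof.
elim: E => [|i E IH] ES; [by left|right].
have Si : S i by apply: ES; rewrite /= inE eqxx.
have [k kE||[b [Sb Eb]]] := IH.
- by apply: ES; rewrite /= inE kE orbT.
- by move=> ->; exists i; split=> // k; rewrite /= inE => /eqP ->; exact: lexx.
have [bi|/ltW ib] := leP b i.
  exists i; split=> // k; rewrite /= inE => /orP[/eqP->|/Eb]; first exact: lexx.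
  by move=> /le_trans; exact.
by exists b; split=> // k; rewrite /= inE => /orP[/eqP->|/Eb].
Qed.

(** This is the limit step of the inductions along omega_1: a nonempty finite set of coordinates in
    [S] lies in one [upto b]. *)
Lemma agree_limit {R : realType} {d : Order.disp_t} {W : orderType d}
    {Y : topologicalType} (K : set Y) (phi psi : Y -> W -> R) (S : set W) :
  compact K -> (forall i, continuous (fun y => phi y i)) ->
  (forall i, continuous (fun y => psi y i)) -> K !=set0 ->
  (forall b, S b -> exists y, K y /\ agree (upto b) (phi y) (psi y)) ->
  exists y, K y /\ agree S (phi y) (psi y).
Proof.
move=> Kc phic psic [y0 Ky0] Kb; apply: approx_agree => // E e ES e0.
have [->|[b [Sb Eb]]] := seq_upto ES; first by exists y0; split.
have [y [Ky yb]] := Kb b Sb; exists y; split=> // i iE.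
by rewrite yb ?subrr ?normr0 //; exact: Eb.
Qed.

(** * Countable bases of boxes and the decoding of predictions *)

Section Boxes.
Context {R : realType} {d : Order.disp_t} {W : orderType d}.
Hypothesis W1 : is_omega1 W.
Implicit Types (x y : W -> R) (a b c : W) (E : seq W).

(** Since [upto a] contains [a], it is never empty and hence is the range of a sequence. *)
Lemma enumerate_upto : exists en : W -> nat -> W, forall a,
  range (en a) = upto a.
Proof.
suff /choice[en enP] : forall a, exists f : nat -> W, range f = upto a by exists en.
move=> a; have /pfcard_geP[E|[f]] := countable_upto W1 a.
  by have := lexx a : upto a a; rewrite E => -[].
by exists f; apply: image_eq.
Qed.

Variable en : W -> nat -> W.
Hypothesis enP : forall a, range (en a) = upto a.

(** An entry [(k, q, m)] will confine coordinate [en a k] to within [1/(m+1)] of [q]. Coding by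
    naturals lets the diamond sequence predict sets of boxes; a number that codes nothing gives the
    unrestricted box. *)
Definition box_code n : seq (nat * rat * nat) := odflt [::] (choice.unpickle n).

Definition box a n : set (W -> R) := [set x |
  forall t, t \in box_code n -> `|x (en a t.1.1) - ratr t.1.2| < t.2.+1%:R^-1].

Lemma box_agree a n x y : agree (upto a) x y -> box a n x -> box a n y.
Proof.
move=> xy xc t tc.
have <- : x (en a t.1.1) = y (en a t.1.1).
  by apply: xy; rewrite -enP; exists t.1.1.
exact: xc.
Qed.

Lemma box_basis a x E (e : R) : [set` E] `<=` upto a -> 0 < e ->
  exists n, box a n x /\ forall y, box a n y -> close_on E e y x.
Proof.
move=> Ea e0.
suff [c [cx cE]] : exists c : seq (nat * rat * nat),
    (forall t, t \in c -> `|x (en a t.1.1) - ratr t.1.2| < t.2.+1%:R^-1) /\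
    (forall y, (forall t, t \in c ->
      `|y (en a t.1.1) - ratr t.1.2| < t.2.+1%:R^-1) -> close_on E e y x).
  by exists (choice.pickle c); rewrite /box /box_code choice.pickleK.
elim: E Ea => [|i E IH] Ea; first by exists [::]; split.
have [k kE|c [cx cE]] := IH; first by apply: Ea; rewrite /= inE kE orbT.
have : upto a i by apply: Ea; rewrite /= inE eqxx.
rewrite -enP => -[k _ ki].
have e20 : 0 < e / 2 by rewrite divr_gt0.
have [m me] := inv_nat_le e20.
have m0 : 0 < m.+1%:R^-1 :> R by rewrite invr_gt0.
have [q] := rat_approx (x i) m0; rewrite distrC => xq.
exists ((k, q, m) :: c); split=> [t|y yc].
  by rewrite inE => /orP[/eqP->/=|/cx //]; rewrite ki.
move=> j; rewrite inE => /orP[/eqP->|jE]; last first.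
  by apply: cE => // t tc; apply: yc; rewrite inE tc orbT.
have := yc (k, q, m); rewrite inE eqxx /= ki => /(_ isT) yq.
rewrite -(subrKA (ratr q)) (splitr e) (le_lt_trans (ler_normD _ _)) //.
by rewrite ltrD ?(lt_le_trans _ me) // distrC.
Qed.

Definition boxes c : set (set (W -> R)) :=
  [set box p.1 p.2 | p in below c `*` [set: nat]].

Lemma countable_boxes c : countable (boxes c).
Proof.
by apply/countable_image/countableX => //; exact: countable_below.
Qed.

(** A nonempty finite subset of [below c] lies in one [upto b] with [b] below [c]; for the empty
    one, the hypothesis on [c] supplies a [b]. *)
Lemma boxes_basis c x E (e : R) : below c !=set0 -> [set` E] `<=` below c ->
  0 < e -> exists B, [/\ boxes c B, B x & forall y, B y -> close_on E e y x].
Proof.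
move=> [b0 b0c] Ec e0.
have [b [bc Eb]] : exists b, below c b /\ [set` E] `<=` upto b.
  by have [->|//] := seq_upto Ec; exists b0.
have [n [xn nE]] := box_basis x Eb e0.
by exists (box b n); split=> //; exists (b, n).
Qed.

(* The set coded by the part of the diamond sequence below [c]. *)
Definition decode (A : W -> set W) (j : W -> nat -> W) c : set (W -> R) :=
  [set x | forall b n, below c b -> A c (j b n) -> ~ box b n x].

End Boxes.

(** * The limit space *)

Section Limit.
Context {R : realType} {d : Order.disp_t} {W : orderType d}.
Hypothesis W1 : is_omega1 W.
Variables (en : W -> nat -> W) (A : W -> set W) (j : W -> nat -> W).
Hypothesis enP : forall a, range (en a) = upto a.
Hypothesis AP : diamond_sequence A.
Hypothesis jI : forall a n b m, j a n = j b m -> a = b /\ n = m.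

Let F : W -> set (W -> R) := decode en A j.

Variable s : W -> @stage R d W.
Hypothesis sP : forall a, good_stage F (fits s (below a)) a (s a).

Context {Z : topologicalType}.
Variable v : Z -> W -> R.
Hypothesis Zc : compact [set: Z].
Hypothesis vc : forall i, continuous (fun z => v z i).
Hypothesis vI : injective v.
Hypothesis vP : forall x, fits s setT x <-> exists z, v z = x.

Implicit Types (a b c : W) (z u : Z) (C K : set Z) (x y : W -> R)
  (E : seq W) (r e : R).

Let Wwo : well_order (<=%O : rel W). Proof. by case: W1. Qed.

Let v_fits z : fits s setT (v z). Proof. by apply/vP; exists z. Qed.

Lemma fits_point S x : (forall a, S a -> upto a `<=` S) -> fits s S x ->
  exists z, agree S (v z) x.
Proof.
move=> SS xS; have [y [yf yx]] := fits_extend W1 sP SS xS.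
by have [z zy] := (vP y).1 yf; exists z; rewrite zy.
Qed.

Lemma rule_value a z : ~ (active (s a) /\ agree (below a) (v z) (centre (s a))) ->
  v z a = value (s a) (v z).
Proof. by move=> N; have [_ /(_ a I)[]] := v_fits z. Qed.

Lemma value_agree a x y : agree (below a) x y -> value (s a) x = value (s a) y.
Proof. by case: (sP a) => + _ _ _ _; exact. Qed.

Lemma closed_compact C : closed C -> compact C.
Proof. by move=> Cc; apply: subclosed_compact Zc _. Qed.

Lemma continuous_const x (i : W) : continuous (fun _ : Z => x i).
Proof. by move=> z; exact: cvg_cst. Qed.

Lemma agree_all z u : agree setT (v z) (v u) -> z = u.
Proof. by move=> zu; apply: vI; apply/funext => i; exact: zu. Qed.

(** * Connectedness of the fibres *)

Definition fibre a x : set Z := [set z | agree (below a) (v z) x].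

Lemma closed_fibre a x : closed (fibre a x).
Proof.
rewrite (_ : fibre a x = \bigcap_(i in below a) ((fun z => v z i) @^-1` [set x i])).
  apply: closed_bigI => i _.
  by apply: closed_comp => [z _|]; [exact: vc|exact: closed_eq].
by apply/seteqP; split=> z.
Qed.

Let I01 : set R := [set r | 0 <= r <= 1].

Lemma connected_unit : connected I01.
Proof.
rewrite (_ : I01 = `[0, 1]%classic); first exact: segment_connected.
by apply/seteqP; split=> r; rewrite /= in_itv.
Qed.

(* Two disjoint closed pieces of a fibre have a first coordinate at which they
   separate; the stage at that coordinate replaces a point by an interval, or
   does nothing. *)
Lemma connected_fibre a x : connected (fibre a x).
Proof.
move=> B B0 [O Oo BO] [D Dc BD]; apply: contrapT => NB.
have BF : B `<=` fibre a x by rewrite BO => z [].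
pose B' := fibre a x `\` B.
have [z0' B'z0'] : B' !=set0.
  apply/set0P/negP => /eqP B'0; apply: NB; apply/seteqP; split=> // z Fz.
  by apply: contrapT => NBz; have : B' z by []; rewrite B'0.
have cB : closed B by rewrite BD; apply: closedI => //; exact: closed_fibre.
have cB' : closed B'.
  rewrite (_ : B' = fibre a x `&` ~` O); last first.
    by rewrite /B' BO; apply/seteqP; split=> z /=; tauto.
  by apply: closedI; [exact: closed_fibre|exact: open_closedC].
have [z0 Bz0] := B0.
(* A pair agreeing on all coordinates would be one point in both pieces, so it suffices to obtain
   [meet (upto b)] by induction on [b]. *)
pose meet S := exists p : Z * Z, (B `*` B') p /\ agree S (v p.1) (v p.2).
have meet_limit (S : set W) : (forall b, S b -> meet (upto b)) -> meet S.
  move=> Sb; apply: agree_limit Sb.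
  - by apply: compact_setX; exact: closed_compact.
  - by move=> i p; apply: (@continuous_comp _ _ _ fst (fun z => v z i));
      [exact: cvg_fst|exact: vc].
  - by move=> i p; apply: (@continuous_comp _ _ _ snd (fun z => v z i));
      [exact: cvg_snd|exact: vc].
  - by exists (z0, z0').
suff meet_upto b : meet (upto b).
  have [[z z'] [[/= Bz [_ NBz']] zz']] := meet_limit setT (fun b _ => meet_upto b).
  by apply: NBz'; rewrite -(agree_all zz').
elim/(well_founded_ind (wo_wf Wwo)): b => b IH.
have [[z z'] [[/= Bz B'z'] zz']] := meet_limit (below b) IH.
apply: contrapT => Nmeet.
have neq u u' : B u -> B' u' -> agree (below b) (v u) (v u') -> v u b <> v u' b.
  move=> Bu B'u' uu' E; apply: Nmeet; exists (u, u'); split=> //.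
  by rewrite upto_below => i [->|/uu'].
have [ba|ab] := ltP b a.
  apply: (neq z z') => //.
  by rewrite (BF _ Bz b ba); case: B'z' => /(_ b ba).
have [[ob zc]|Nc] := pselect (active (s b) /\ agree (below b) (v z) (centre (s b)));
  last first.
  apply: (neq z z') => //; rewrite !rule_value //.
    exact: value_agree.
  by move=> [ob z'c]; apply: Nc; split=> //; exact: agree_trans z'c.
(* [Q] is the fibre over the centre of stage [b]. The values at [b] on its parts in [B] and [B']
   would split the unit interval into two disjoint nonempty closed sets. *)
pose Q := [set u | agree (below b) (v u) (centre (s b))].
have QF : Q `<=` fibre a x.
  move=> u uc; apply: agree_trans (BF _ Bz).
  have /(agreeS (S' := below b)) : below a `<=` below b by move=> i /lt_le_trans; exact.
  by apply; apply: agree_trans uc _; exact: agreeC.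
have Qc : closed Q by exact: closed_fibre.
pose V K := (fun u => v u b) @` (Q `&` K).
have Vc K : closed K -> closed (V K).
  move=> Kc; apply: compact_closed; first exact: Rhausdorff.
  apply: continuous_compact; first by apply: continuous_subspaceT; exact: vc.
  by apply: closed_compact; exact: closedI.
have V01 K : V K `<=` I01 by move=> _ [u _ <-]; case: (v_fits u) => + _; exact.
have Vdisj r : V B r -> V B' r -> False.
  move=> [u [Qu Bu] <-] [u' [Qu' B'u'] E]; apply: (neq u u') => //.
  by apply: agree_trans Qu _; exact: agreeC.
have Vcover : I01 `<=` V B `|` V B'.
  move=> r r01; have [y [yf yc yb]] := fits_blowup W1 sP ob r01.
  have [u uy] := (vP y).1 yf; have Qu : Q u by rewrite /Q /= uy.
  by have [Bu|NBu] := pselect (B u); [left|right]; exists u => //;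
    rewrite ?uy //; split=> //; split=> //; exact: QF.
have VB : V B = I01.
  apply: connected_unit; first by exists (v z b), z.
    exists (~` V B'); first by apply: closed_openC; exact: Vc.
    apply/seteqP; split=> r.
      by move=> VBr; split=> [|V'r]; [exact: V01 VBr|exact: Vdisj V'r].
    by move=> [/Vcover[]].
  exists (V B); first exact: Vc.
  by apply/seteqP; split=> r; [move=> h; split=> //; exact: V01 h|case].
have V'z' : V B' (v z' b).
  exists z' => //; split=> //; apply: agree_trans zc; exact: agreeC.
by apply: (Vdisj (v z' b)) => //; rewrite VB; exact: V01 V'z'.
Qed.

(** This is the cylinder over the projection of [C] to the coordinates below [a], the form in which
    closed sets are predicted. *)
Definition shadow C a : set (W -> R) :=
  [set x | exists z, C z /\ agree (below a) (v z) x].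

Lemma shadow_agree C a x y : agree (below a) x y -> shadow C a x -> shadow C a y.
Proof. by move=> xy [z [Cz zx]]; exists z; split=> //; exact: agree_trans zx xy. Qed.

Lemma box_open a n : open [set z | box en a n (v z)].
Proof.
rewrite /box /=; elim: (box_code n) => [|t c IH].
  by rewrite (_ : mkset _ = setT); [exact: openT|apply/seteqP; split].
rewrite (_ : mkset _ = [set z | `|v z (en a t.1.1) - ratr t.1.2| < t.2.+1%:R^-1] `&`
    [set z | forall t, t \in c ->
      `|v z (en a t.1.1) - ratr t.1.2| < t.2.+1%:R^-1]); last first.
  apply/seteqP; split=> z /=.
    by move=> h; split=> [|t' t'c]; apply: h; rewrite inE ?eqxx // t'c orbT.
  by move=> [zt zc] t'; rewrite inE => /orP[/eqP->//|]; exact: zc.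
apply: openI => //.
rewrite (_ : mkset _ = (fun z => `|v z (en a t.1.1) - ratr t.1.2|) @^-1`
  [set r : R | r < t.2.+1%:R^-1]) //.
apply: open_comp => [z _|]; last exact: open_lt.
apply: (@cvg_norm R R Z (nbhs z) _ (fun z => v z (en a t.1.1) - ratr t.1.2)).
by apply: (@cvgB R R Z (nbhs z) _ (fun z => v z _) (fun=> ratr t.1.2));
  [exact: vc|exact: cvg_cst].
Qed.

Lemma boxes_open a B : boxes en a B -> open [set z | B (v z)].
Proof. by move=> [[b n] _ <-]; exact: box_open. Qed.

(** The diamond sequence guesses which boxes miss [C]. Then [F c] is the complement of the guessed
    boxes, and it equals the shadow because the projection of the compact set [C] is closed. *)
Lemma guess C : closed C -> exists c, below c !=set0 /\ F c = shadow C c.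
Proof.
move=> Cc.
have [c [c0 cP]] := diamond_guess W1 AP jI
  (fun b n => forall z, C z -> ~ box en b n (v z)).
exists c; split=> //; apply/seteqP; split=> [x Fx|x [z [Cz zx]] b n bc Ab Bx].
  apply: (approx_agree (closed_compact Cc) vc (fun i => @continuous_const x i)).
  move=> E e Ec e0; have [_ [[[b n] [/= bc _] <-] Bx BE]] := boxes_basis enP x c0 Ec e0.
  apply: contrapT => NC; apply: (Fx b n bc) => //.
  by apply/(cP b n bc) => z Cz Bz; apply: NC; exists z; split=> //; exact: BE.
move: Ab => /(cP b n bc)/(_ z Cz); apply; apply: (box_agree enP _ Bx).
by apply: agreeC; apply: agreeS zx; exact: sub_below_upto.
Qed.

(** By induction on [b] from [c] on, every point over [F c] is matched in [K] on [upto b]. Only the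
    centre of an active stage leaves freedom at [b]; there the oscillation of [value] on [F c]
    yields points of [K] approximating any prescribed coordinate. *)
Lemma irreducible c C K : below c !=set0 -> F c = shadow C c -> closed K ->
  (forall z, C z -> exists u, K u /\ agree (below c) (v u) (v z)) ->
  forall z, F c (v z) -> K z.
Proof.
move=> c0 FC Kc CK z0 Fz0.
have K0 : K !=set0.
  by move: Fz0; rewrite FC => -[u [/CK[u' [Ku' _]] _]]; exists u'.
have Kcompact := closed_compact Kc.
have limit z (S : set W) :
    (forall b, S b -> exists u, K u /\ agree (upto b) (v u) (v z)) ->
  exists u, K u /\ agree S (v u) (v z).
  exact: (agree_limit Kcompact vc (fun i => @continuous_const (v z) i) K0).
suff Kupto b : (c <= b)%O -> forall z, F c (v z) ->
    exists u, K u /\ agree (upto b) (v u) (v z).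
  have [b _|u [Ku /agree_all<-//]] := limit z0 setT.
  have [cb|/ltW bc] := leP c b; first exact: Kupto.
  have [u [Ku uz]] := Kupto c (lexx c) z0 Fz0; exists u; split=> //.
  by apply: agreeS uz => i /le_trans; exact.
elim/(well_founded_ind (wo_wf Wwo)): b => b IH cb.
have below_b z : F c (v z) -> exists u, K u /\ agree (below b) (v u) (v z).
  move=> Fz; apply: limit => b' b'b; have [cb'|b'c] := leP c b'.
    exact: IH.
  move: Fz; rewrite FC => -[z' [/CK[u [Ku uz']] z'z]]; exists u; split=> //.
  by apply: agreeS (agree_trans uz' z'z); exact: sub_below_upto.
move=> z Fz.
have [[ob zc]|Nc] := pselect (active (s b) /\ agree (below b) (v z) (centre (s b)));
  last first.
  have [u [Ku uz]] := below_b z Fz; exists u; split=> //.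
  rewrite upto_below => i [->|/uz//]; rewrite !rule_value //.
    exact: value_agree.
  by move=> [ob uc]; apply: Nc; split=> //; apply: agree_trans uc; exact: agreeC.
have Fc : F c (centre (s b)).
  rewrite FC; rewrite FC in Fz; apply: shadow_agree Fz.
  by apply: agreeS zc => i /lt_le_trans; exact.
have [_ _ _ /(_ ob)[_ _ osc] _] := sP b.
apply: (approx_agree Kcompact vc (fun i => @continuous_const (v z) i)) => E e Eb e0.
pose E' := [seq i <- E | i != b].
have E'b : [set` E'] `<=` below b.
  move=> i /=; rewrite mem_filter => /andP[ib /Eb].
  by rewrite upto_below => -[E1|//]; rewrite E1 eqxx in ib.
have z01 : 0 <= v z b <= 1 by case: (v_fits z) => + _; exact.
have predF : predicted F b (F c) by exists c.
(* [y] is near the centre but off its class, and its [value] is near [v z b]. A point of [K]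
   matching [y] below [b] must then have this value as its coordinate [b]. *)
have [y [Yy Fy Ny yE' ye]] := osc _ predF Fc _ _ _ z01 E'b e0.
have [w wy] := fits_point (fun a => @sub_below_upto _ _ a b) Yy.
have [u [Ku uw]] : exists u, K u /\ agree (below b) (v u) (v w).
  apply: below_b; rewrite FC; rewrite FC in Fy; apply: shadow_agree Fy.
  by apply: agreeC; apply: agreeS wy => i /lt_le_trans; exact.
have uy := agree_trans uw wy.
exists u; split=> // i iE; have [->|ib] := eqVneq i b.
  rewrite rule_value => [|[_ uc]]; first by rewrite (value_agree uy).
  by apply: Ny; apply: agree_trans uc; exact: agreeC.
have iE' : i \in E' by rewrite mem_filter ib.
by rewrite uy ?zc; [exact: yE'|exact: E'b|exact: E'b].
Qed.

Lemma determined C : closed C -> exists c, [/\ below c !=set0, F c = shadow C c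
  & forall K, closed K ->
    (forall z, C z -> exists u, K u /\ agree (below c) (v u) (v z)) ->
    forall z, F c (v z) -> K z].
Proof.
by move=> /guess[c [c0 Fc]]; exists c; split=> // K; exact: irreducible.
Qed.

(** Nothing is predicted at the bottom and [target] is trivial, so any point of the cube is
    admissible there. *)
Lemma bottom_active b : below b = set0 -> active (s b).
Proof.
move=> b0; apply: contrapT => Nb; have [_ _ _ _ /(_ Nb (fun=> 0))] := sP b.
apply; split=> [|[x]|B [a [[x xa] ab] _] _]; [|by rewrite b0|].
  by split=> [i|i]; [rewrite lexx ler01|rewrite b0].
have : below b x by exact: lt_le_trans xa ab.
by rewrite b0.
Qed.

Lemma blowup_points a : active (s a) -> exists z0 z1,
  [/\ fibre a (centre (s a)) z0, fibre a (centre (s a)) z1 & z0 <> z1].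
Proof.
move=> oa.
have [|y0 [y0f y0c y0a]] := fits_blowup W1 sP oa (r := 0).
  by rewrite lexx ler01.
have [|y1 [y1f y1c y1a]] := fits_blowup W1 sP oa (r := 1).
  by rewrite lexx ler01.
have [z0 E0] := (vP y0).1 y0f; have [z1 E1] := (vP y1).1 y1f.
exists z0, z1; split; rewrite /fibre /= ?E0 ?E1 // => E.
have : y0 a = y1 a by rewrite -E0 -E1 E.
by rewrite y0a y1a => /eqP; rewrite eq_sym oner_eq0.
Qed.

(** The whole space is a fibre at the bottom stage, hence connected, and it has two points; an
    isolated point would be clopen. *)
Lemma not_scattered : accessible_space Z -> ~ scattered_space Z.
Proof.
move=> acc sc; have [b bmin] := omega1_bot W1.
have b0 : below b = set0.
  by apply/seteqP; split=> // x; rewrite /below /= ltNge bmin.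
have [z0 [z1 [_ _ z01]]] := blowup_points (bottom_active b0).
have [|z [_ [V zV VE]]] := sc setT; first by exists z0.
have Fb : fibre b (v z) = setT by apply/seteqP; split=> // u _ i; rewrite b0.
have VT : [set z] = fibre b (v z).
  apply: connected_fibre; first by exists z.
    exists [set z]; last by rewrite Fb setTI.
    move: VE; rewrite setIT => VE; rewrite openE => _ ->.
    by rewrite /interior -VE.
  by exists [set z]; [exact: accessible_closed_set1|rewrite Fb setTI].
have allz u : u = z by have : [set z] u by rewrite VT Fb.
by apply: z01; rewrite (allz z0) (allz z1).
Qed.

(** [D] takes a point of [B] for each of countably many boxes, inside the box if [B] meets it. The
    closures of [D] and [B] then have the same projection below [c], and irreducibility puts [B]
    into the closure of [D]. *)
Lemma hereditary_dense (B : set Z) :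
  exists D, [/\ D `<=` B, countable D & B `<=` closure D].
Proof.
have [[b0 Bb0]|B0] := pselect (B !=set0); last first.
  by exists set0; split=> // z Bz; case: B0; exists z.
have [c [c0 Fc irr]] := determined (@closed_closure _ B).
have /choice[pick pickP] (X : set (W -> R)) : exists z, B z /\
    ((exists u, B u /\ X (v u)) -> X (v z)).
  have [[u [Bu Xu]]|N] := pselect (exists u, B u /\ X (v u)); first by exists u.
  by exists b0; split=> // ?; case: N.
pose D := pick @` boxes en c; exists D; split.
- by move=> _ [X _ <-]; case: (pickP X).
- by apply: countable_image; exact: countable_boxes.
move=> z Bz; apply: (irr (closure D)).
- exact: closed_closure.
- move=> u clu.
  apply: (approx_agree (closed_compact (@closed_closure _ D)) vc
    (fun i => @continuous_const (v u) i)) => E e Ec e0.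
  have [X [bX Xu XE]] := boxes_basis enP (v u) c0 Ec e0.
  have [|u' [Bu' Xu']] := clu [set z | X (v z)].
    by apply: open_nbhs_nbhs; split=> //; exact: boxes_open bX.
  exists (pick X); split; first by apply: subset_closure; exists X.
  by apply: XE; case: (pickP X) => _; apply; exists u'.
- by rewrite Fc; exists z; split=> //; exact: subset_closure.
Qed.

(** The complement [C] of the union is the full preimage of its projection below [c]. So the compact
    fibre of a covered point lies in finitely many [O i], and these cover a whole box around the
    point. There are only countably many boxes. *)
Lemma hereditary_cover (I : choiceType) (D : set I) (O : I -> set Z) :
  (forall i, D i -> open (O i)) ->
  exists G, [/\ G `<=` D, countable G & \bigcup_(i in D) O i `<=` \bigcup_(i in G) O i].
Proof.
move=> Oo.
pose C := ~` \bigcup_(i in D) O i.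
have Cc : closed C by apply: open_closedC; exact: bigcup_open.
have [c [c0 Fc irr]] := determined Cc.
pose covers (X : set (W -> R)) (S : seq I) :=
  forall z, X (v z) -> exists i, [/\ i \in S, D i & O i z].
have /choice[pick pickP] (X : set (W -> R)) : exists S : seq I,
    (exists S, covers X S) -> covers X S.
  have [[S XS]|N] := pselect (exists S, covers X S); first by exists S.
  by exists [::].
exists (D `&` \bigcup_(X in boxes en c) [set` pick X]); split.
- by move=> i [].
- apply: sub_countable (bigcup_countable (countable_boxes W1 en c) _).
    by apply: subset_card_le => i [_]; exact.
  by move=> X _; exact: finite_set_countable.
move=> x [i0 Di0 Oi0x].
have Nshadow z : agree (below c) (v z) (v x) -> ~ C z.
  move=> zx Cz; have : C x; last by apply; exists i0.
  apply: (irr C Cc); first by move=> u Cu; exists u; split.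
  by rewrite Fc; exists z.
pose f i := [set z | D i -> ~ O i z].
have fc i : closed (f i).
  have [Di|NDi] := pselect (D i); last first.
    rewrite (_ : f i = setT); first exact: closedT.
    by apply/seteqP; split=> // z _ /NDi.
  rewrite (_ : f i = ~` O i); first by apply: open_closedC; exact: Oo.
  by apply/seteqP; split=> z; [exact|move=> h _].
have [S SP] : exists S : seq I, forall z, agree (below c) (v z) (v x) ->
    exists i, [/\ i \in S, D i & O i z].
  apply: contrapT => NS.
  have [S|z [zx zf]] := compact_family (closed_compact (@closed_fibre c (v x))) fc.
    apply: contrapT => Nf; apply: NS; exists S => z zx.
    apply: contrapT => Nz; apply: Nf; exists z; split=> // i iS Di Oiz.
    by apply: Nz; exists i.
  by apply: (Nshadow z zx) => -[i Di]; exact: (zf i Di).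
pose K := [set z | forall i, i \in S -> f i z].
have Kc : closed K.
  rewrite (_ : K = \bigcap_(i in [set` S]) f i); first exact: closed_bigI.
  by apply/seteqP; split.
have [X [bX Xx XK]] : exists X, [/\ boxes en c X, X (v x) & forall z, X (v z) -> ~ K z].
  apply: contrapT => NX.
  have [E e Ec e0|z [Kz zx]] := approx_agree (closed_compact Kc) vc
    (fun i => @continuous_const (v x) i) (S := below c).
    have [X [bX Xx XE]] := boxes_basis enP (v x) c0 Ec e0.
    apply: contrapT => NK; apply: NX; exists X; split=> // z Xz Kz.
    by apply: NK; exists z; split=> //; exact: XE.
  by have [i [iS Di Oiz]] := SP z zx; exact: Kz iS Di Oiz.
have [|i [iX Di Oix]] := pickP X _ x Xx.
  exists S => z /XK NKz; apply: contrapT => Nz; apply: NKz => i iS Di Oiz.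
  by apply: Nz; exists i.
by exists i => //; split=> //; exists X.
Qed.

(** * Perfect sets: a category argument and the exclusion of totally disconnected ones *)

Lemma close_slack E e x y : 0 < e -> close_on E e x y ->
  exists2 t, 0 < t & forall w : W -> R,
    (forall i, i \in E -> `|w i - x i| <= t) -> close_on E e w y.
Proof.
move=> e0; elim: E => [|i E IH] xy; first by exists 1.
have [k kE|t t0 tP] := IH; first by apply: xy; rewrite inE kE orbT.
have xyi : `|x i - y i| < e by apply: xy; rewrite inE eqxx.
exists (Num.min t ((e - `|x i - y i|) / 2)).
  by rewrite lt_min t0 divr_gt0 // subr_gt0.
move=> w wx k; rewrite inE => /orP[/eqP->|kE].
  have := wx i; rewrite inE eqxx => /(_ isT); rewrite le_min => /andP[_].
  by have := ler_normD (w i - x i) (x i - y i); rewrite subrKA; lra.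
apply: tP kE => l lE; have := wx l; rewrite inE lE orbT => /(_ isT).
by rewrite le_min => /andP[].
Qed.

(* Baire category: the agreement classes modulo [S] are nowhere dense in [P]. *)
Lemma avoid (S : set W) (P : set Z) (Q : set (W -> R)) :
  closed P -> P !=set0 -> countable Q ->
  (forall z, P z -> nonisolated S (v @` P) (v z)) ->
  exists z, P z /\ forall q, Q q -> ~ agree S (v z) q.
Proof.
move=> Pc [z0 Pz0] /pfcard_geP[->|[g]] Pnon.
  by exists z0; split=> // q [].
pose q n := g n.
pose U (t : Z * seq W * R) : set Z :=
  [set u | P u /\ forall i, i \in t.1.2 -> `|v u i - v t.1.1 i| <= t.2].
pose ok (t : Z * seq W * R) := [/\ P t.1.1, [set` t.1.2] `<=` S & 0 < t.2].
have Uc t : closed (U t).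
  rewrite (_ : U t = P `&` \bigcap_(i in [set` t.1.2])
      ((fun u => `|v u i - v t.1.1 i|) @^-1` [set r : R | r <= t.2])); last first.
    by apply/seteqP; split.
  apply: closedI => //; apply: closed_bigI => i _.
  apply: closed_comp => [u _|]; last exact: closed_le.
  apply: (@cvg_norm R R Z (nbhs u) _ (fun u => v u i - v t.1.1 i)).
  by apply: (@cvgB R R Z (nbhs u) _ (fun u => v u i) (fun=> v t.1.1 i));
    [exact: vc|exact: cvg_cst].
have stepP (p : nat * (Z * seq W * R)) : exists t', ok p.2 ->
    [/\ ok t', U t' `<=` U p.2 & forall u, U t' u -> ~ agree S (v u) (q p.1)].
  case: p => n [[z E] e] /=.
  have [okt|Nok] := pselect (ok (z, E, e)); last by exists (z, E, e).
  have [/= Pz ES e0] := okt.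
  have [z1 [Pz1 z1z Nz1]] : exists z1,
      [/\ P z1, close_on E e (v z1) (v z) & ~ agree S (v z1) (q n)].
    have [zq|Nzq] := pselect (agree S (v z) (q n)); last first.
      by exists z; split=> // i _; rewrite subrr normr0.
    have [_ [[z1 Pz1 <-] Nz1 z1z]] := Pnon z Pz E e ES e0.
    exists z1; split=> // z1q; apply: Nz1; apply: agree_trans z1q _; exact: agreeC.
  have [i [Si iq]] : exists i, S i /\ v z1 i != q n i.
    apply: contrapT => Ni; apply: Nz1 => i Si; apply/eqP/negPn/negP => iq.
    by apply: Ni; exists i.
  have [t t0 tP] := close_slack e0 z1z.
  have iq0 : 0 < `|v z1 i - q n i| by rewrite normr_gt0 subr_eq0.
  (* The new coordinate [i], with a radius of at most half the gap there, keeps the whole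
     neighbourhood off the class of [q n]. *)
  exists (z1, i :: E, Num.min t (`|v z1 i - q n i| / 2)) => _; split.
  - split=> //= [k|]; last by rewrite lt_min t0 divr_gt0.
    by rewrite /= inE => /orP[/eqP->//|/ES].
  - move=> u [Pu /= uz1]; split=> //= k kE; apply/ltW; apply: tP kE => l lE.
    have := uz1 l; rewrite inE lE orbT => /(_ isT).
    by rewrite le_min => /andP[].
  - move=> u [Pu /= uz1] /(_ i Si) uq.
    have := uz1 i; rewrite inE eqxx uq => /(_ isT).
    by rewrite le_min distrC => /andP[_]; lra.
have [step {}stepP] := choice stepP.
pose fix t n := if n is m.+1 then step (m, t m) else (z0, [::], 1 : R).
have tok n : ok (t n).
  by elim: n => [|n IH]; [split=> //=; rewrite ltr01|have [] := stepP (n, t n) IH].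
have tsub n m : (n <= m)%N -> U (t m) `<=` U (t n).
  move=> /subnKC <-; elim: (m - n)%N => [|k IH]; first by rewrite addn0.
  rewrite addnS; apply: subset_trans IH.
  by have [] := stepP (n + k, t (n + k))%N (tok _).
have tcentre n : U (t n) (t n).1.1.
  by have [Pn _ e0] := tok n; split=> // i _; rewrite subrr normr0 ltW.
have [s'|z [Pz zU]] := compact_family (closed_compact Pc) (fun n => Uc (t n)).
  pose N := (\max_(n <- s') n)%N; exists (t N).1.1.
  split=> [|n ns]; first by case: (tok N).
  by apply: tsub (tcentre N); rewrite /N (big_rem n ns) /= leq_maxl.
exists z; split=> // _ /(surj (f := g))[n _ <-].
by have [_ _ h] := stepP (n, t n) (tok n); exact: h (zU n.+1).
Qed.

Lemma no_perfect_totally_disconnected (P : set Z) :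
  perfect P -> totally_disconnected P -> False.
Proof.
move=> [P0 [Pc Plim]] Ptd.
have [c [c0 Fc irr]] := determined Pc.
have sat z : F c (v z) -> P z.
  by apply: irr => // u Pu; exists u; split.
have fibreP x : F c x -> fibre c x `<=` P.
  move=> Fx z zx; apply: sat; rewrite Fc; rewrite Fc in Fx.
  by apply: shadow_agree Fx; exact: agreeC.
have fibre1 x z u : F c x -> fibre c x z -> fibre c x u -> u = z.
  move=> Fx zx ux; have Pz := fibreP x Fx z zx.
  have : connected_component P z u.
    by exists (fibre c x) => //; split=> //; [exact: fibreP|exact: connected_fibre].
  by rewrite Ptd.
have PF z : P z -> F c (v z) by move=> Pz; rewrite Fc; exists z.
have [oc|Nc] := pselect (active (s c)).
  have [z0 [z1 [z0c z1c]]] := blowup_points oc; apply.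
  have [_ _ _ /(_ oc)[_ /(_ c0) Fcc _] _] := sP c.
  exact: fibre1 Fcc z1c z0c.
(* As fibres over [F c] are single points, a point of [P] other than [z] already differs from [z]
   below [c]. *)
have Pnon z : P z -> nonisolated (below c) (v @` P) (v z).
  move=> Pz E e Ec e0.
  have : limit_point P z by rewrite Plim.
  case/(_ [set u | close_on E e (v u) (v z)]).
    have zE i : nbhs z [set u | `|v u i - v z i| < e].
      have /cvgrPdist_lt/(_ e e0) := @vc i z.
      by apply: filterS => u; rewrite distrC.
    elim: (E) => [|i E' IH]; first by apply: filterS filterT => u _ i.
    apply: filterS (filterI (zE i) IH) => u [ui uE] k.
    by rewrite inE => /orP[/eqP->|/uE].
  move=> u [/eqP uz Pu uE]; exists (v u); split=> // uzc.
  by apply: uz; apply: (fibre1 (v z)) => //; exact: PF.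
(* A bad [x] in both sets of [p] is isolated in [p.1] by the box [p.2], up to agreement below [c].
   For each [p] such points of the stage form at most one class, so the countably many [q p]
   represent them all. *)
pose bad (p : set (W -> R) * set (W -> R)) x :=
  forall y, fits s (below c) y -> p.1 y -> p.2 y -> agree (below c) y x.
have /choice[q qP] p : exists x, (exists x, bad p x) -> bad p x.
  have [[x px]|N] := pselect (exists x, bad p x); first by exists x.
  by exists (fun=> 0).
have [|z [Pz zq]] := avoid (Q := q @` (predicted F c `*` boxes en c)) Pc P0 _ Pnon.
  apply: countable_image; apply: countableX; first exact: countable_predicted.
  exact: countable_boxes.
(* [z] avoids every class [q p] and so is admissible, whereas stage [c] is inactive for want of such
   a point. *)
have [_ _ _ _ /(_ Nc (v z))] := sP c; apply; split.
- by have [z01 zr] := v_fits z; split=> // a _; exact: zr.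
- by move=> _; exact: PF.
move=> B FB Bz E e Ec e0.
have [X [bX Xz XE]] := boxes_basis enP (v z) c0 Ec e0.
apply: contrapT => Nz.
have badz : bad (B, X) (v z).
  move=> y Yy By Xy; apply: contrapT => Nyz; apply: Nz; exists y; split=> //.
  exact: XE.
apply: (zq (q (B, X))); first by exists (B, X).
apply: (qP (B, X)) => //; first by exists (v z).
by have [z01 zr] := v_fits z; split=> // a _; exact: zr.
Qed.

End Limit.

(** * Subspaces and the theorem *)

Lemma set_type_openP (Y : topologicalType) (A : set Y) (U : set (set_type A)) :
  open U <-> exists2 V, open V & set_val @^-1` V = U.
Proof. by split=> -[V Vo VU]; exists V. Qed.

Lemma continuous_set_val (Y : topologicalType) (A : set Y) :
  continuous (set_val : set_type A -> Y).
Proof. exact: initial_continuous. Qed.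

Lemma compact_set_type (Y : topologicalType) (A : set Y) :
  compact A -> compact [set: set_type A].
Proof.
move=> Ac G GG _.
have [|x [Ax xG]] := Ac (set_val @ G) _.
  by apply: (@filterS _ G _ setT) filterT => z _; exact: (set_valP z).
exists (SigSub (mem_set Ax)); split=> // B V GB.
rewrite nbhsE => -[U [/set_type_openP[U' oU' <-] U'x] UV].
have [||_ [[z Bz <-] U'z]] := xG (set_val @` B) U'.
- by apply: (@filterS _ G _ B) GB => z Bz; exists z.
- exact: open_nbhs_nbhs.
by exists z; split=> //; exact: UV.
Qed.

Lemma hereditarily_separable (Y : topologicalType) :
  (forall B : set Y, exists D, [/\ D `<=` B, countable D & B `<=` closure D]) ->
  hereditarily separable_space Y.
Proof.
move=> Y_dense A; have [D [DA cD AD]] := Y_dense A.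
exists (set_val @^-1` D).
  apply: sub_countable cD; apply: card_ge_preimage => x y _ _.
  exact: val_inj.
move=> O [x Ox] /set_type_openP[V oV VO].
have [|d [Dd Vd]] := AD (set_val x) (set_valP x) V.
  by apply: open_nbhs_nbhs; split=> //; move: Ox; rewrite -VO.
by exists (SigSub (mem_set (DA _ Dd))); split=> //; rewrite -VO.
Qed.

Lemma hereditarily_lindelof (Y : topologicalType) :
  (forall (I : choiceType) (D : set I) (O : I -> set Y),
    (forall i, D i -> open (O i)) ->
    exists G, [/\ G `<=` D, countable G &
      \bigcup_(i in D) O i `<=` \bigcup_(i in G) O i]) ->
  hereditarily lindelof_space Y.
Proof.
move=> Y_cover A F Fo FT.
have /choice[O OP] (U : {classic set (set_type A)}) :
    exists V, F U -> open V /\ set_val @^-1` V = U.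
  have [/Fo/set_type_openP[V oV VU]|NFU] := pselect (F U); first by exists V.
  by exists set0 => /NFU.
have [|G [GF cG FG]] := Y_cover {classic set (set_type A)} F O.
  by move=> U /OP[].
exists G; split=> //; apply/seteqP; split=> // x _.
have [U FU Ux] : (\bigcup_(U in F) U) x by rewrite FT.
have [|U' GU' U'x] := FG (set_val x); last first.
  by exists U' => //; have [_ <-] := OP U' (GF _ GU').
by exists U => //; have [_ UE] := OP U FU; move: Ux; rewrite -{1}UE.
Qed.

Theorem theorem1p3 :
  diamond ->
  exists X : topologicalType,
    [/\ hausdorff_space X, weird X,
        hereditarily separable_space X & hereditarily lindelof_space X].
Proof.
move=> [d [W [W1 [A AP]]]].
pose R := Rdefinitions.R : realType.
have [j jI] := omega1_pairing W1.
have [en enP] := enumerate_upto W1.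
have [s sP] := tower (R := R) (decode en A j) W1.
pose T := prod_topology (fun _ : W => R).
pose S : set T := [set x | fits s setT x].
have Sc : compact S.
  have cube := @tychonoff W (fun=> R) (fun=> `[0, 1]%classic)
    (fun=> @segment_compact R 0 1).
  (* [S] is closed in the cube, since each [rule] is a closed condition by the third clause of
     [good_stage]. *)
  rewrite (_ : S = [set x : T | forall i, x i \in `[0, 1]] `&`
      \bigcap_a [set x : T | rule s a x]); last first.
    apply/seteqP; split=> x /= [x01 xr]; split=> [i|a _]; try exact: xr;
    by have := x01 i; rewrite in_itv.
  rewrite setIC; apply: (subclosed_compact _ cube) => [|x []//].
  apply: closedI; first by apply: closed_bigI => a _; case: (sP a).
  rewrite (_ : mkset _ = \bigcap_i ((fun x : T => x i) @^-1` `[0, 1])); last first.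
    by apply/seteqP; split=> [x x01 i _|x x01 i]; exact: x01.
  apply: closed_bigI => i _; apply: closed_comp => [x _|].
    exact: continuous_coord.
  exact: itv_closed.
pose X := set_type S; pose v (z : X) : W -> R := set_val z.
have Xc : compact [set: X] by exact: compact_set_type.
have vc i : continuous (fun z => v z i).
  move=> z; apply: (@continuous_comp X T R set_val (fun x => x i)).
    exact: continuous_set_val.
  exact: continuous_coord.
have vI : injective v by move=> z u /val_inj.
have vP x : fits s setT x <-> exists z, v z = x.
  split=> [fx|[z <-]]; last exact: (set_valP z).
  by exists (SigSub (mem_set (fx : S x))).
have Xh : hausdorff_space X.
  move=> z u zu; apply: vI; apply/funext => i.
  apply: (@Rhausdorff R) => B C zB uC.
  have [w [Bw Cw]] := zu _ _ (vc i z _ zB) (vc i u _ uC).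
  by exists (v w i).
exists X; split=> //.
- split=> //.
    apply: (not_scattered W1 sP Xc vc vI vP); exact: hausdorff_accessible.
  move=> [P [Pp Ptd]].
  exact: (no_perfect_totally_disconnected W1 enP AP jI sP Xc vc vI vP Pp Ptd).
- apply: hereditarily_separable.
  exact: (hereditary_dense W1 enP AP jI sP Xc vc vI vP).
- apply: hereditarily_lindelof.
  exact: (hereditary_cover W1 enP AP jI sP Xc vc vI vP).
Qed.
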